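(* Let $R$ be a ring and $n\geq 1$ an integer. The map $\mathbf{U}\mapsto M_n(R,\mathbf{U})$ establishes a lattice isomorphism between: (i) the lattice $\{\mathbf{U}\in M_n(\mathcal{I}(R)): \mathbf{U}^2+\mathbf{I}\leq \mathbf{U}\}$ of $n\times n$ reflexive-transitive matrices with ideal entries, and (ii) the lattice of subrings of $M_n(R)$ containing all diagonal matrices.
   Context: Rings are possibly non-commutative and have a unit element $1$, with $1\neq 0$. Subrings are required to contain the unit element. $M_n(R)$ is the ring of $n\times n$ matrices over $R$, with entries of $A$ written $A(i,j)$, $i,j\in\{1,\dots,n\}$. $\mathcal{I}(R)$ is the set of bilateral (two-sided) ideals of $R$, including the trivial ideal $(0)$ and the improper ideal $(1)=R$; it is a semiring under ideal sum and ideal product, lattice-ordered by inclusion. $M_n(\mathcal{I}(R))$ is the set of $n\times n$ matrices with entries in $\mathcal{I}(R)$, with the usual matrix sum and product: $(\mathbf{U}+\mathbf{V})(i,j)=\mathbf{U}(i,j)+\mathbf{V}(i,j)$ and $(\mathbf{U}\mathbf{V})(i,j)=\sum_{k=1}^n \mathbf{U}(i,k)\mathbf{V}(k,j)$. It is ordered by entrywise inclusion: $\mathbf{U}\leq\mathbf{V}$ means $\mathbf{U}(i,j)\subseteq\mathbf{V}(i,j)$ for all $i,j$. $\mathbf{I}\in M_n(\mathcal{I}(R))$ is the matrix with the ideal $R$ in diagonal positions and $(0)$ in off-diagonal positions. A matrix $\mathbf{U}\in M_n(\mathcal{I}(R))$ is called reflexive-transitive if $\mathbf{U}^2+\mathbf{I}\leq\mathbf{U}$.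 The set of reflexive-transitive matrices is a (complete) lattice under the order $\leq$ restricted from $M_n(\mathcal{I}(R))$ (in general not a sublattice of $M_n(\mathcal{I}(R))$). The lattice in (ii) is ordered by inclusion. For reflexive-transitive $\mathbf{U}$, $$M_n(R,\mathbf{U})=\{A\in M_n(R): A(i,j)\in\mathbf{U}(i,j)\text{ for all } i,j\},$$ which is a subring of $M_n(R)$. *)

(* Defs.v *)
From HB Require Import structures.
From mathcomp Require Import all_boot all_order all_algebra.
From mathcomp Require Import boolp classical_sets.

Set Implicit Arguments.
Unset Strict Implicit.
Unset Printing Implicit Defensive.

Import Order.TTheory GRing.Theory.
Local Open Scope classical_set_scope.
Local Open Scope ring_scope.

Section Ideals.
Variable R : pzRingType.

Definition ideal_closed (I : set R) : Prop :=
  [/\ I 0,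
      forall x y, I x -> I y -> I (x - y),
      forall a x, I x -> I (a * x)
    & forall a x, I x -> I (x * a)].

(* Two-sided ideals; (0) and R itself are allowed, unlike in ring_quotient,
   whose ideals are proper. *)
Record ideal := Ideal {
  ideal_set : set R;
  idealP : ideal_closed ideal_set
}.

(* Classical equality and choice, required by the algebraic hierarchy. *)
HB.instance Definition _ := gen_eqMixin ideal.
HB.instance Definition _ := gen_choiceMixin ideal.

Lemma ideal_eq (I J : ideal) :
  (forall x, ideal_set I x <-> ideal_set J x) -> I = J.
Proof.
case: I J => [I Ic] [J Jc] /= IJ.
have eIJ : I = J by apply/predeqP.
by rewrite -eIJ in Jc *; rewrite (Prop_irrelevance Ic Jc).
Qed.

Lemma ideal0 (I : ideal) : ideal_set I 0. Proof. by case: (idealP I). Qed.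
Lemma idealB (I : ideal) x y :
  ideal_set I x -> ideal_set I y -> ideal_set I (x - y).
Proof. by case: (idealP I) => _ + _ _; apply. Qed.
Lemma idealMl (I : ideal) a x : ideal_set I x -> ideal_set I (a * x).
Proof. by case: (idealP I) => _ _ + _; apply. Qed.
Lemma idealMr (I : ideal) a x : ideal_set I x -> ideal_set I (x * a).
Proof. by case: (idealP I) => _ _ _; apply. Qed.
Lemma idealD (I : ideal) x y :
  ideal_set I x -> ideal_set I y -> ideal_set I (x + y).
Proof.
move=> Ix Iy; rewrite -[y]opprK; apply: idealB => //.
by rewrite -sub0r; apply: idealB => //; apply: ideal0.
Qed.
Lemma ideal_sum (I : ideal) (T : Type) (r : seq T) (P : pred T) (F : T -> R) :
  (forall t, P t -> ideal_set I (F t)) ->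
  ideal_set I (\sum_(t <- r | P t) F t).
Proof.
move=> IF; apply: (big_ind (ideal_set I)) => //; first exact: ideal0.
by move=> x y; apply: idealD.
Qed.

Lemma zero_ideal_closed : ideal_closed [set 0].
Proof.
split=> //= [x y -> ->|a x ->|a x ->]; rewrite ?subr0 //.
- by rewrite mulr0.
- by rewrite mul0r.
Qed.
Definition zero_ideal := Ideal zero_ideal_closed.

Lemma unit_ideal_closed : ideal_closed [set: R]. Proof. by []. Qed.
Definition unit_ideal := Ideal unit_ideal_closed.

Definition add_set (I J : set R) : set R := [set x + y | x in I & y in J].

Lemma add_ideal_closed (I J : ideal) :
  ideal_closed (add_set (ideal_set I) (ideal_set J)).
Proof.
split=> [|_ _ [x Ix [y Jy <-]] [x' Ix' [y' Jy' <-]]|a _ [x Ix [y Jy <-]]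
  |a _ [x Ix [y Jy <-]]].
- by exists 0; [exact: ideal0|exists 0; [exact: ideal0|rewrite addr0]].
- exists (x - x'); first exact: idealB.
  by exists (y - y'); [exact: idealB|rewrite opprD addrACA].
- exists (a * x); first exact: idealMl.
  by exists (a * y); [exact: idealMl|rewrite mulrDr].
- exists (x * a); first exact: idealMr.
  by exists (y * a); [exact: idealMr|rewrite mulrDl].
Qed.
Definition add_ideal (I J : ideal) := Ideal (add_ideal_closed I J).

(* Ideal product: finite sums of products, not just products. *)
Definition mul_set (I J : set R) : set R :=
  [set x | exists s : seq (R * R),
     (forall p, p \in s -> I p.1 /\ J p.2) /\ x = \sum_(p <- s) p.1 * p.2].

Lemma mul_set_gen (I J : set R) x y : I x -> J y -> mul_set I J (x * y).
Proof.
move=> Ix Jy; exists [:: (x, y)]; rewrite big_seq1; split=> // p.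
by rewrite inE => /eqP ->.
Qed.

Lemma mul_set_addr (I J : set R) x y :
  mul_set I J x -> mul_set I J y -> mul_set I J (x + y).
Proof.
move=> [s [sP ->]] [t [tP ->]]; exists (s ++ t); rewrite big_cat; split=> // p.
by rewrite mem_cat => /orP[/sP|/tP].
Qed.

Lemma mul_ideal_closed (I J : ideal) :
  ideal_closed (mul_set (ideal_set I) (ideal_set J)).
Proof.
have mulL a x : mul_set (ideal_set I) (ideal_set J) x ->
    mul_set (ideal_set I) (ideal_set J) (a * x).
  move=> [s [sP ->]]; exists [seq (a * p.1, p.2) | p <- s]; split.
    by move=> _ /mapP[p /sP[Ip Jp] ->]; split=> //; apply: idealMl.
  by rewrite big_map mulr_sumr; apply: eq_bigr => p _; rewrite mulrA.
split=> // [|x y Ix Iy|a _ [s [sP ->]]].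
- by exists [::]; rewrite big_nil.
- by apply: mul_set_addr => //; rewrite -mulN1r; apply: mulL.
- exists [seq (p.1, p.2 * a) | p <- s]; split.
    by move=> _ /mapP[p /sP[Ip Jp] ->]; split=> //; apply: idealMr.
  by rewrite big_map mulr_suml; apply: eq_bigr => p _; rewrite mulrA.
Qed.
Definition mul_ideal (I J : ideal) := Ideal (mul_ideal_closed I J).

Lemma mul_ideal_sub (I J K : ideal) :
  (forall x y, ideal_set I x -> ideal_set J y -> ideal_set K (x * y)) ->
  ideal_set (mul_ideal I J) `<=` ideal_set K.
Proof.
move=> IJK _ [s [sP ->]]; rewrite big_seq; apply: ideal_sum => p /sP[].
exact: IJK.
Qed.

Lemma mul_ideal_gen (I J : ideal) x y :
  ideal_set I x -> ideal_set J y -> ideal_set (mul_ideal I J) (x * y).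
Proof. exact: mul_set_gen. Qed.

Lemma add_ideal_sub (I J K : ideal) :
  ideal_set I `<=` ideal_set K -> ideal_set J `<=` ideal_set K ->
  ideal_set (add_ideal I J) `<=` ideal_set K.
Proof. by move=> IK JK _ [x /IK Ix [y /JK Jy <-]]; apply: idealD. Qed.

Lemma add_ideal_subl (I J : ideal) :
  ideal_set I `<=` ideal_set (add_ideal I J).
Proof. by move=> x Ix; exists x => //; exists 0; [exact: ideal0|rewrite addr0]. Qed.

Lemma add_ideal_subr (I J : ideal) :
  ideal_set J `<=` ideal_set (add_ideal I J).
Proof. by move=> x Ix; exists 0; [exact: ideal0|exists x; rewrite ?add0r]. Qed.

Lemma ideal_anti (I J : ideal) :
  ideal_set I `<=` ideal_set J -> ideal_set J `<=` ideal_set I -> I = J.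
Proof. by move=> IJ JI; apply: ideal_eq => x; split=> [/IJ|/JI]. Qed.

Lemma add_idealA : associative add_ideal.
Proof.
move=> I J K; apply: ideal_anti.
- apply: add_ideal_sub => [x Ix|]; last apply: add_ideal_sub => x Ix.
  + by do 2 apply: add_ideal_subl.
  + by apply: add_ideal_subl; apply: add_ideal_subr.
  + by apply: add_ideal_subr.
- apply: add_ideal_sub => [|x Ix]; first apply: add_ideal_sub => x Ix.
  + by apply: add_ideal_subl.
  + by apply: add_ideal_subr; apply: add_ideal_subl.
  + by do 2 apply: add_ideal_subr.
Qed.

Lemma add_idealC : commutative add_ideal.
Proof.
by move=> I J; apply: ideal_anti; apply: add_ideal_sub;
  (exact: add_ideal_subl || exact: add_ideal_subr).
Qed.

Lemma add0_ideal : left_id zero_ideal add_ideal.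
Proof.
move=> I; apply: ideal_anti; last exact: add_ideal_subr.
by apply: add_ideal_sub => // _ ->; apply: ideal0.
Qed.

Lemma mul_idealA : associative mul_ideal.
Proof.
move=> I J K; apply: ideal_anti.
- apply: mul_ideal_sub => x _ Ix [s [sP ->]].
  rewrite mulr_sumr big_seq; apply: ideal_sum => p /sP[Jp Kp].
  by rewrite mulrA; do 2 apply: mul_ideal_gen => //.
- apply: mul_ideal_sub => _ z [s [sP ->]] Kz.
  rewrite mulr_suml big_seq; apply: ideal_sum => p /sP[Ip Jp].
  by rewrite -mulrA; do 2 apply: mul_ideal_gen => //.
Qed.

Lemma mul1_ideal : left_id unit_ideal mul_ideal.
Proof.
move=> I; apply: ideal_anti; first by apply: mul_ideal_sub => x y _; apply: idealMl.
by move=> x Ix; rewrite -[x]mul1r; apply: mul_ideal_gen.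
Qed.

Lemma mul_ideal1 : right_id unit_ideal mul_ideal.
Proof.
move=> I; apply: ideal_anti; first by apply: mul_ideal_sub => x y /idealMr.
by move=> x Ix; rewrite -[x]mulr1; apply: mul_ideal_gen.
Qed.

Lemma mul_idealDl : left_distributive mul_ideal add_ideal.
Proof.
move=> I J K; apply: ideal_anti.
- apply: mul_ideal_sub => _ z [x Ix [y Jy <-]] Kz; rewrite mulrDl.
  by apply: idealD; [apply: add_ideal_subl|apply: add_ideal_subr];
    apply: mul_ideal_gen.
- by apply: add_ideal_sub; apply: mul_ideal_sub => x y Ix Jy;
    apply: mul_ideal_gen => //; [apply: add_ideal_subl|apply: add_ideal_subr].
Qed.

Lemma mul_idealDr : right_distributive mul_ideal add_ideal.
Proof.
move=> I J K; apply: ideal_anti.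
- apply: mul_ideal_sub => z _ Iz [x Ix [y Jy <-]]; rewrite mulrDr.
  by apply: idealD; [apply: add_ideal_subl|apply: add_ideal_subr];
    apply: mul_ideal_gen.
- by apply: add_ideal_sub; apply: mul_ideal_sub => x y Ix Jy;
    apply: mul_ideal_gen => //; [apply: add_ideal_subl|apply: add_ideal_subr].
Qed.

Lemma mul0_ideal : left_zero zero_ideal mul_ideal.
Proof.
move=> I; apply: ideal_anti; last by move=> _ ->; apply: ideal0.
by apply: mul_ideal_sub => _ y -> _; rewrite mul0r.
Qed.

Lemma mul_ideal0 : right_zero zero_ideal mul_ideal.
Proof.
move=> I; apply: ideal_anti; last by move=> _ ->; apply: ideal0.
by apply: mul_ideal_sub => x _ _ ->; rewrite mulr0.
Qed.

HB.instance Definition _ :=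
  GRing.isNmodule.Build ideal add_idealA add_idealC add0_ideal.
HB.instance Definition _ :=
  GRing.Nmodule_isPzSemiRing.Build ideal mul_idealA mul1_ideal mul_ideal1
    mul_idealDl mul_idealDr mul0_ideal mul_ideal0.

Lemma ideal_inf_closed (P : set ideal) :
  ideal_closed (\bigcap_(I in P) ideal_set I).
Proof.
split=> [I _|x y Px Py I PI|a x Px I PI|a x Px I PI].
- exact: ideal0.
- by apply: idealB; [apply: Px|apply: Py].
- exact/idealMl/Px.
- exact/idealMr/Px.
Qed.
Definition ideal_inf (P : set ideal) := Ideal (ideal_inf_closed P).

End Ideals.

Section ReflexiveTransitive.
Variables (R : pzRingType) (n : nat).

Definition lemx (U V : 'M[ideal R]_n) : Prop :=
  forall i j, ideal_set (U i j) `<=` ideal_set (V i j).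

(* Sum, product and identity are those of matrices over the semiring of
   ideals: 1%:M has R on the diagonal and (0) elsewhere. *)
Definition reflexive_transitive (U : 'M[ideal R]_n) : Prop :=
  lemx (U ^+ 2 + 1%:M) U.

Record rtmx := RTmx {
  rtmx_val :> 'M[ideal R]_n;
  rtmxP : reflexive_transitive rtmx_val
}.

HB.instance Definition _ := gen_eqMixin rtmx.
HB.instance Definition _ := gen_choiceMixin rtmx.

Lemma rtmx_inj : injective rtmx_val.
Proof.
move=> [U Ut] [V Vt] /= eUV; rewrite -eUV in Vt *.
by rewrite (Prop_irrelevance Ut Vt).
Qed.

Lemma ideal_set_sum (T : finType) (F : T -> ideal R) t :
  ideal_set (F t) `<=` ideal_set (\sum_s F s).
Proof. by rewrite (bigD1 t) //=; apply: add_ideal_subl. Qed.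

Lemma reflexive_transitiveE (U : 'M[ideal R]_n) :
  reflexive_transitive U <->
  (forall i, ideal_set (U i i) 1) /\
  (forall i j k x y, ideal_set (U i k) x -> ideal_set (U k j) y ->
     ideal_set (U i j) (x * y)).
Proof.
split=> [Urt|[Ur Ut] i j].
  split=> [i|i j k x y Ux Uy]; apply: Urt; rewrite !mxE.
    by apply: add_ideal_subr; rewrite eqxx.
  apply: add_ideal_subl; apply: (ideal_set_sum (t := k)).
  exact: mul_ideal_gen.
rewrite !mxE; apply: add_ideal_sub.
  apply: (big_ind (fun I : ideal R => ideal_set I `<=` ideal_set (U i j))).
  - by move=> _ ->; apply: ideal0.
  - by move=> I J; apply: add_ideal_sub.
  - by move=> k _; apply: mul_ideal_sub => x y; apply: Ut.
case: eqVneq => [->|_] x; last by move=> ->; apply: ideal0.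
by move=> _; rewrite -[x]mulr1; apply: idealMl.
Qed.

Definition mx_inf (P : set rtmx) : 'M[ideal R]_n :=
  \matrix_(i, j) ideal_inf [set (U : rtmx) i j | U in P].

Lemma mx_infE P i j x :
  ideal_set (mx_inf P i j) x <-> forall U, P U -> ideal_set (U i j) x.
Proof.
rewrite mxE; split=> [Px U PU|Px _ [U PU <-]]; last exact: Px.
by apply: Px; exists U.
Qed.

Lemma mx_inf_rt (P : set rtmx) : reflexive_transitive (mx_inf P).
Proof.
apply/reflexive_transitiveE; split=> [i|i j k x y].
  by apply/mx_infE => U PU; have [Ur _] := (reflexive_transitiveE U).1 (@rtmxP U); apply: Ur.
move=> /mx_infE Px /mx_infE Py; apply/mx_infE => U PU.
have [_ Ut] := (reflexive_transitiveE U).1 (@rtmxP U).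
by apply: (Ut i j k); [apply: Px|apply: Py].
Qed.
Definition rtmx_inf (P : set rtmx) := @RTmx (mx_inf P) (@mx_inf_rt P).

Definition rtmx_le (U V : rtmx) : bool := `[< lemx U V >].

Fact rtmx_display : Order.disp_t. Proof. exact: Order.Disp tt tt. Qed.

Lemma rtmx_le_refl : reflexive rtmx_le.
Proof. by move=> U; apply/asboolP => i j. Qed.
Lemma rtmx_le_anti : antisymmetric rtmx_le.
Proof.
move=> U V /andP[/asboolP UV /asboolP VU]; apply/rtmx_inj/matrixP => i j.
exact: ideal_anti.
Qed.
Lemma rtmx_le_trans : transitive rtmx_le.
Proof.
move=> V U W /asboolP UV /asboolP VW; apply/asboolP => i j.
exact: subset_trans (UV i j) (VW i j).
Qed.

HB.instance Definition _ := Order.Le_isPOrder.Build rtmx_display rtmx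
  rtmx_le_refl rtmx_le_anti rtmx_le_trans.

Definition rtmx_meet (U V : rtmx) := rtmx_inf [set U; V].
(* The join is the least reflexive-transitive upper bound; in general it is
   larger than the entrywise sum. *)
Definition rtmx_join (U V : rtmx) := rtmx_inf [set W | lemx U W /\ lemx V W].

Lemma rtmx_meetP U V W : rtmx_le U (rtmx_meet V W) = rtmx_le U V && rtmx_le U W.
Proof.
apply/asboolP/andP => [UVW|[/asboolP UV /asboolP UW] i j x Ux].
  by split; apply/asboolP => i j x /UVW/mx_infE; apply; [left|right].
by apply/mx_infE => _ [->|->]; [apply: UV|apply: UW].
Qed.

Lemma rtmx_joinP U V W : rtmx_le (rtmx_join U V) W = rtmx_le U W && rtmx_le V W.
Proof.
apply/asboolP/andP => [UVW|[/asboolP UW /asboolP VW] i j x /mx_infE]; last exact.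
by split; apply/asboolP => i j x Ux; apply: UVW; apply/mx_infE => T [UT VT];
  [apply: UT|apply: VT].
Qed.

HB.instance Definition _ := Order.POrder_MeetJoin_isLattice.Build
  rtmx_display rtmx rtmx_meetP rtmx_joinP.

End ReflexiveTransitive.

Section DiagonalSubrings.
Variables (R : pzRingType) (n : nat).

Record diag_subring := DiagSubring {
  diag_subring_set : set 'M[R]_n;
  diag_subringP : subring_closed (mem diag_subring_set);
  diag_subring_diag : forall A, is_diag_mx A -> diag_subring_set A
}.

HB.instance Definition _ := gen_eqMixin diag_subring.
HB.instance Definition _ := gen_choiceMixin diag_subring.

Lemma diag_subring_inj : injective diag_subring_set.
Proof.
move=> [S Sr Sd] [T Tr Td] /= eST; rewrite -eST in Tr Td *.
by rewrite (Prop_irrelevance Sr Tr) (Prop_irrelevance Sd Td).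
Qed.

Section Inf.
Variable P : set diag_subring.
Definition mx_set_inf : set 'M[R]_n := \bigcap_(S in P) diag_subring_set S.

Lemma mx_set_inf_subring : subring_closed (mem mx_set_inf).
Proof.
split=> [|A B /set_mem PA /set_mem PB|A B /set_mem PA /set_mem PB];
  apply/mem_set => S PS; apply/set_mem; have [S1 SB SM] := diag_subringP S.
- exact: S1.
- by apply: SB; apply/mem_set; [apply: PA|apply: PB].
- by apply: SM; apply/mem_set; [apply: PA|apply: PB].
Qed.

Lemma mx_set_inf_diag A : is_diag_mx A -> mx_set_inf A.
Proof. by move=> Ad S _; apply: diag_subring_diag. Qed.

Definition diag_subring_inf := DiagSubring mx_set_inf_subring mx_set_inf_diag.
End Inf.

Definition diag_subring_le (S T : diag_subring) : bool :=
  `[< diag_subring_set S `<=` diag_subring_set T >].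

Fact diag_subring_display : Order.disp_t. Proof. exact: Order.Disp tt tt. Qed.

Lemma diag_subring_le_refl : reflexive diag_subring_le.
Proof. by move=> S; apply/asboolP. Qed.
Lemma diag_subring_le_anti : antisymmetric diag_subring_le.
Proof.
move=> S T /andP[/asboolP ST /asboolP TS].
by apply/diag_subring_inj/seteqP.
Qed.
Lemma diag_subring_le_trans : transitive diag_subring_le.
Proof.
by move=> T S W /asboolP ST /asboolP TW; apply/asboolP; apply: subset_trans TW.
Qed.

HB.instance Definition _ := Order.Le_isPOrder.Build
  diag_subring_display diag_subring
  diag_subring_le_refl diag_subring_le_anti diag_subring_le_trans.

Definition diag_subring_meet (S T : diag_subring) :=
  diag_subring_inf [set S; T].
Definition diag_subring_join (S T : diag_subring) :=
  diag_subring_inf [set W | diag_subring_set S `<=` diag_subring_set W /\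
                            diag_subring_set T `<=` diag_subring_set W].

Lemma diag_subring_meetP S T W :
  diag_subring_le S (diag_subring_meet T W) =
  diag_subring_le S T && diag_subring_le S W.
Proof.
apply/asboolP/andP => [STW|[/asboolP ST /asboolP SW] A SA].
  by split; apply/asboolP => A /STW; apply; [left|right].
by move=> _ [->|->]; [apply: ST|apply: SW].
Qed.

Lemma diag_subring_joinP S T W :
  diag_subring_le (diag_subring_join S T) W =
  diag_subring_le S W && diag_subring_le T W.
Proof.
apply/asboolP/andP => [STW|[/asboolP SW /asboolP TW] A]; last by apply; split.
by split; apply/asboolP => A SA; apply: STW => X [SX TX];
  [apply: SX|apply: TX].
Qed.

HB.instance Definition _ := Order.POrder_MeetJoin_isLattice.Build
  diag_subring_display diag_subring diag_subring_meetP diag_subring_joinP.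

End DiagonalSubrings.

Definition mx_entries_in (R : pzRingType) (n : nat) (U : 'M[ideal R]_n) :
    set 'M[R]_n :=
  [set A | forall i j, ideal_set (U i j) (A i j)].

(* Main.v *)
Require Import Defs.
From HB Require Import structures.
From mathcomp Require Import all_boot all_order all_algebra.
From mathcomp Require Import boolp classical_sets.

(** Write [elem_mx a i j] for the matrix with single entry [a] in position
    (i, j). Multiplying [A] on the left by a matrix with one entry in column
    [k] and on the right by one with one entry in row [l] isolates the entry
    [A k l] (lemma [elem_mx_corner]). When the two factors are diagonal they
    belong to any subring [S] containing the diagonal matrices, so [S] contains
    [elem_mx (a * A i j * b) i j] for each [A] in [S] and all [a], [b]. Hence

    - [S] is determined by the sets [S_ij] of the [x] with [elem_mx x i j] in
      [S]: it consists of the matrices with (i, j) entry in [S_ij], since a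
      matrix is the sum of its [elem_mx (A i j) i j];
    - each [S_ij] is a two-sided ideal;
    - the product of [elem_mx x i k] and [elem_mx y k j] shows that
      [S_ik S_kj] lies in [S_ij], and [S_ii] contains 1 because [elem_mx 1 i i]
      is diagonal: the matrix of the [S_ij] is reflexive-transitive.

    Thus [S] is mapped to the matrix of the [S_ij] by the inverse of
    [U |-> M_n(R, U)]. The same elementary matrices show that inclusion of
    [M_n(R, U)] in [M_n(R, V)] forces entrywise inclusion of [U] in [V]. So the
    map is an isomorphism of ordered sets, and such a map between lattices
    preserves meets and joins, as these are determined by the order. *)

Set Implicit Arguments.
Unset Strict Implicit.
Unset Printing Implicit Defensive.

Import Order.TTheory GRing.Theory.
Local Open Scope classical_set_scope.
Local Open Scope ring_scope.

Section OrderIsomorphism.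
Variables (d d' : Order.disp_t) (L : latticeType d) (L' : latticeType d').
Variables (f : L -> L') (g : L' -> L).
Hypotheses (gK : cancel g f) (f_mono : {mono f : x y / (x <= y)%O}).

(** The upper bound on [f x `&` f y] needs surjectivity: writing that meet as
    [f z] turns the claim into [z <= x `&` y], which is tested in [L']. *)
Lemma order_iso_meet : Order.meet_morphism f.
Proof.
move=> x y; apply/le_anti; rewrite lexI !f_mono leIl leIr /=.
by rewrite -[X in (X <= _)%O]gK f_mono lexI -!f_mono gK leIl leIr.
Qed.

Lemma order_iso_join : Order.join_morphism f.
Proof.
move=> x y; apply/le_anti; rewrite leUx !f_mono leUl leUr !andbT.
by rewrite -[X in (_ <= X)%O]gK f_mono leUx -!f_mono gK leUl leUr.
Qed.

End OrderIsomorphism.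

Section ElementaryMatrices.
Variables (R : pzRingType) (n : nat).
Implicit Types A : 'M[R]_n.

Definition elem_mx (a : R) (i j : 'I_n) : 'M[R]_n := a *: delta_mx i j.

Lemma elem_mxE a i j k l :
  elem_mx a i j k l = if (k == i) && (l == j) then a else 0.
Proof. by rewrite !mxE; case: ifP; rewrite ?mulr1 ?mulr0. Qed.

Lemma elem_mxB a b i j : elem_mx (a - b) i j = elem_mx a i j - elem_mx b i j.
Proof. exact: scalerBl. Qed.

Lemma elem_mx0 i j : elem_mx 0 i j = 0. Proof. exact: scale0r. Qed.

Lemma elem_mx_diag a i : is_diag_mx (elem_mx a i i).
Proof.
apply/is_diag_mxP => k l kl; rewrite elem_mxE.
by case: eqP => // ki; case: eqP => // li; rewrite ki li eqxx in kl.
Qed.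

Lemma elem_mx_corner a b i j k l A :
  elem_mx a i k *m A *m elem_mx b l j = elem_mx (a * A k l * b) i j.
Proof.
apply/matrixP => p q; rewrite mxE (bigD1 l) //= big1 => [|m ml]; last first.
  by rewrite elem_mxE (negPf ml) mulr0.
rewrite mxE (bigD1 k) //= big1 => [|m mk]; last first.
  by rewrite elem_mxE (negPf mk) andbF mul0r.
rewrite !elem_mxE !eqxx !andbT /= !addr0.
by case: (p == i); case: (q == j); rewrite /= ?(mul0r, mulr0).
Qed.

Lemma mul_elem_mx a b i j k :
  elem_mx a i k *m elem_mx b k j = elem_mx (a * b) i j.
Proof.
by rewrite -[elem_mx a i k]mulmx1 elem_mx_corner mxE eqxx mulr1.
Qed.

End ElementaryMatrices.

Section MatricesWithEntriesInIdeals.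
Variables (R : pzRingType) (n : nat).

Lemma elem_mx_entries_in (U : 'M[ideal R]_n) a i j :
  mx_entries_in U (elem_mx a i j) <-> ideal_set (U i j) a.
Proof.
split=> [/(_ i j)|Ua k l]; rewrite elem_mxE ?eqxx //.
by case: eqP => [->|_]; [case: eqP => [->|_]|] => //=; apply: ideal0.
Qed.

Variable U : rtmx R n.

Lemma mx_entries_in_subring :
  subring_closed (mem (mx_entries_in (rtmx_val U))).
Proof.
have [Ur Ut] := (reflexive_transitiveE U).1 (@rtmxP _ _ U).
split=> [|A B /set_mem UA /set_mem UB|A B /set_mem UA /set_mem UB];
  apply/mem_set => i j.
- by rewrite mxE; case: eqVneq => [->|_]; [apply: Ur|apply: ideal0].
- by rewrite !mxE; apply: idealB; [apply: UA|apply: UB].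
- rewrite mxE; apply: ideal_sum => k _.
  by apply: (Ut i j k); [apply: UA|apply: UB].
Qed.

Lemma mx_entries_in_diag A : is_diag_mx A -> mx_entries_in (rtmx_val U) A.
Proof.
have [Ur _] := (reflexive_transitiveE U).1 (@rtmxP _ _ U).
move=> /is_diag_mxP Ad i j; have [->|ij] := eqVneq i j.
  by rewrite -[A j j]mulr1; apply/idealMl/Ur.
by rewrite Ad //; apply: ideal0.
Qed.

Definition subring_of_rtmx : diag_subring R n :=
  DiagSubring mx_entries_in_subring mx_entries_in_diag.

End MatricesWithEntriesInIdeals.

Section EntryIdeals.
Variables (R : pzRingType) (n : nat) (S : diag_subring R n).
Let inS := diag_subring_set S.

Lemma diag_subringB A B : inS A -> inS B -> inS (A - B).
Proof.
have [_ SB _] := diag_subringP S.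
by move=> SA SA'; apply/set_mem/SB; apply/mem_set.
Qed.

Lemma diag_subring0 : inS 0.
Proof. by apply: diag_subring_diag; apply: mx0_is_diag. Qed.

Lemma diag_subringD A B : inS A -> inS B -> inS (A + B).
Proof.
move=> SA SB; rewrite -[B]opprK; apply: diag_subringB => //.
by rewrite -sub0r; apply: diag_subringB => //; apply: diag_subring0.
Qed.

Lemma diag_subringM A B : inS A -> inS B -> inS (A *m B).
Proof.
have [_ _ SM] := diag_subringP S.
by move=> SA SB; apply/set_mem/SM; apply/mem_set.
Qed.

(** Both outer factors of the corner identity are diagonal here. *)
Lemma diag_subring_corner a b i j A :
  inS A -> inS (elem_mx (a * A i j * b) i j).
Proof.
move=> SA; rewrite -elem_mx_corner.
by do 2?[apply: diag_subringM] => //; apply: diag_subring_diag;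
  apply: elem_mx_diag.
Qed.

Lemma entry_ideal_closed i j : ideal_closed [set x | inS (elem_mx x i j)].
Proof.
have ent x : elem_mx x i j i j = x by rewrite elem_mxE !eqxx.
split=> [|x y /= Sx Sy|a x /=|a x /=].
- by rewrite /= elem_mx0; apply: diag_subring0.
- by rewrite elem_mxB; apply: diag_subringB.
- by move/(diag_subring_corner a 1 i j); rewrite ent mulr1.
- by move/(diag_subring_corner 1 a i j); rewrite ent mul1r.
Qed.

Definition entry_ideals : 'M[ideal R]_n :=
  \matrix_(i, j) Ideal (entry_ideal_closed i j).

Lemma entry_idealsE i j x :
  ideal_set (entry_ideals i j) x = inS (elem_mx x i j).
Proof. by rewrite mxE. Qed.

Lemma entry_ideals_rt : reflexive_transitive entry_ideals.
Proof.
apply/reflexive_transitiveE; split=> [i|i j k x y]; rewrite !entry_idealsE.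
  by apply: diag_subring_diag; apply: elem_mx_diag.
by move=> Sx Sy; rewrite -(mul_elem_mx x y i j k); apply: diag_subringM.
Qed.

Definition rtmx_of_subring : rtmx R n := RTmx entry_ideals_rt.

(** [S] contains each matrix with entries in the [S_ij] by summing elementary
    matrices; conversely the corner identity with a = b = 1 extracts the
    elementary matrices of an element of [S]. *)
Lemma mx_entries_in_entry_ideals : mx_entries_in entry_ideals = inS.
Proof.
apply/seteqP; split=> A SA; last first.
  move=> i j; rewrite entry_idealsE -[A i j]mul1r -[1 * _]mulr1.
  exact: diag_subring_corner.
rewrite [A]matrix_sum_delta.
apply: (big_ind inS) => [||i _]; [exact: diag_subring0|exact: diag_subringD|].
apply: (big_ind inS) => [||j _]; [exact: diag_subring0|exact: diag_subringD|].
by have := SA i j; rewrite entry_idealsE.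
Qed.

End EntryIdeals.

Section Isomorphism.
Variables (R : pzRingType) (n : nat).

Lemma rtmx_of_subringK :
  cancel (@rtmx_of_subring R n) (@subring_of_rtmx R n).
Proof. by move=> S; apply/diag_subring_inj/mx_entries_in_entry_ideals. Qed.

Lemma subring_of_rtmxK :
  cancel (@subring_of_rtmx R n) (@rtmx_of_subring R n).
Proof.
move=> U; apply/rtmx_inj/matrixP => i j; apply: ideal_eq => x.
by rewrite entry_idealsE; apply: elem_mx_entries_in.
Qed.

(** Inclusion of the matrix rings is tested on elementary matrices, which see
    one entry ideal at a time. *)
Lemma subring_of_rtmx_mono :
  {mono (@subring_of_rtmx R n) : U V / (U <= V)%O}.
Proof.
move=> U V; apply/asboolP/asboolP => UV.
  by move=> i j x /elem_mx_entries_in /UV /elem_mx_entries_in.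
by move=> A UA i j; apply/UV/UA.
Qed.

HB.instance Definition _ :=
  Order.isOrderMorphism.Build _ (rtmx R n) _ (diag_subring R n)
    (@subring_of_rtmx R n) (mono2W subring_of_rtmx_mono).

HB.instance Definition _ :=
  Order.isLatticeMorphism.Build _ (rtmx R n) _ (diag_subring R n)
    (@subring_of_rtmx R n)
    (order_iso_meet rtmx_of_subringK subring_of_rtmx_mono)
    (order_iso_join rtmx_of_subringK subring_of_rtmx_mono).

End Isomorphism.

Theorem proposition4 (R : nzRingType) (n : nat) (n_ge1 : (1 <= n)%N) :
  exists f : {lmorphism rtmx R n -> diag_subring R n},
    (forall U : rtmx R n, diag_subring_set (f U) = mx_entries_in (rtmx_val U)) /\
    bijective f.
Proof.
exists (@subring_of_rtmx R n); split=> //.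
by exists (@rtmx_of_subring R n);
  [exact: subring_of_rtmxK|exact: rtmx_of_subringK].
Qed.
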